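(* Let $G$ be a group, let $X$ be a $\mathbf 0$-distributive bounded $G$-lattice, and let $A\subset X$ be a subset of finite cardinality $|A|=n\in\mathbb N$ with $\bigvee A=\mathbf 1$. Then there is an element $a\in A$ with $\operatorname{lar}(\Delta(a))\le \phi(n+1)$ and $p_X(a)\ge\frac1{\phi(n+1)}$.
   Context: A lattice is a set $X$ with two commutative, associative, idempotent binary operations $\vee,\wedge$ satisfying $x\vee(x\wedge y)=x$ and $x\wedge(x\vee y)=x$; it is partially ordered by $x\le y$ iff $x\wedge y=x$. It is bounded if it has a least element $\mathbf 0$ and a greatest element $\mathbf 1$, and it is assumed that $\mathbf 0\neq\mathbf 1$. A bounded lattice is $\mathbf 0$-distributive if $x\wedge(y\vee z)=(x\wedge y)\vee(x\wedge z)$ for all $x,y,z$ with $x\wedge y=\mathbf 0$. For a finite $A=\{a_1,\dots,a_n\}\subset X$, $\bigvee A=a_1\vee\dots\vee a_n$. A $G$-lattice is a lattice with an action of the group $G$ such that each map $x\mapsto gx$ is a lattice automorphism. For $a\in X$, $\Delta(a)=\{g\in G: ga\wedge a\neq\mathbf 0\}$. For nonempty $D\subset G$, $\operatorname{lar}(D)=\min\{|F|:F\subset G,\ G=F\cdot D\}$ (a cardinal); for $D=\emptyset$, $\operatorname{lar}(D)$ is the smallest infinite cardinal greater than $|G|$. The Protasov density is $p_X(a)=1/\operatorname{lar}(\Delta(a))$ if $0<\operatorname{lar}(\Delta(a))<\omega$, and $p_X(a)=0$ otherwise. For an integer $m\ge2$, $\phi(m)=\sup_{1<x<m}\frac{x^{m-x}-1}{x-1}$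 (supremum over real $x$). *)

(* Defs.v *)
From HB Require Import structures.
From mathcomp Require Export all_boot all_order all_algebra.
From mathcomp Require Export finmap.
From mathcomp Require Export mathcomp_extra boolp classical_sets functions cardinality.
From mathcomp Require Export reals exp.

Set Implicit Arguments.
Unset Strict Implicit.
Unset Printing Implicit Defensive.

Definition zero_distributive d (X : tbLatticeType d) : Prop :=
  (forall x y z : X, x `&` y = \bot ->
     x `&` (y `|` z) = (x `&` y) `|` (x `&` z))%O.

Definition lattice_automorphism d (X : latticeType d) (f : X -> X) : Prop :=
  [/\ bijective f,
      (forall x y : X, f (x `|` y) = f x `|` f y)%O &
      (forall x y : X, f (x `&` y) = f x `&` f y)%O].

Definition lattice_action (G : groupType) d (X : latticeType d)
    (act : G -> X -> X) : Prop :=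
  [/\ (forall x, act 1%g x = x),
      (forall g h x, act (g * h)%g x = act g (act h x)) &
      (forall g, lattice_automorphism (act g))].

Definition Delta (G : groupType) d (X : tbLatticeType d) (act : G -> X -> X)
    (a : X) : set G :=
  [set g | (act g a `&` a)%O <> \bot%O]%classic.

Section Lar.
Local Open Scope classical_set_scope.
Local Open Scope card_scope.
Variable G : groupType.

Definition covers (F D : set G) : Prop :=
  [set (f * d)%g | f in F & d in D] = [set: G].

(* A cardinal is given by any set K representing it: [is_lar D K] says that
   lar(D) is the cardinality of K, which determines K up to equipotence. *)
Definition is_lar (D : set G) (T : Type) (K : set T) : Prop :=
  (D !=set0 ->
     (exists2 F : set G, covers F D & K #= F) /\
     (forall F : set G, covers F D -> K #<= F)) /\
  (D = set0 ->
     [/\ infinite_set K, [set: G] #<= K, ~ (K #<= [set: G]) &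
         forall (U : Type) (L : set U),
           infinite_set L -> [set: G] #<= L -> ~ (L #<= [set: G]) ->
           K #<= L]).

(* An infinite cardinal is larger than every real number; `I_k is the set of
   the k first natural numbers. *)
Definition lar_le (R : realType) (D : set G) (r : R) : Prop :=
  exists2 k : nat, is_lar D `I_k & (k%:R <= r)%R.

End Lar.

Definition protasov_density (R : realType) (G : groupType) d
    (X : tbLatticeType d) (act : G -> X -> X) (a : X) : R :=
  xget 0%R [set r : R | exists k : nat,
    [/\ (0 < k)%N, is_lar (Delta act a) `I_k & r = (1 / k%:R)%R]]%classic.

(* For m >= 2 this set is nonempty and bounded (the quotient tends to m - 1 as
   x tends to 1), so that [sup] is the true supremum. *)
Definition phi (R : realType) (m : nat) : R :=
  (sup [set (x `^ (m%:R - x) - 1) / (x - 1) |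
         x in [set x : R | 1 < x < m%:R]]%classic)%R.

(* Main.v *)
(* Suppose that lar(Delta(a)) > phi(n+1) for every a in A.  Then for i in A and
   any family of at most phi(n+1) translates of i there is a further translate
   g i disjoint from all of them.  Hence from a cover of 1 by translates of
   elements of A all translates of i can be removed: by 0-distributivity g i
   lies below the join of the other translates, so i lies below the shift of
   this join by g^-1.  Replacing elements of the cover A by such joins produces
   new covers and hence new bounds on every i.  At stage k, every i lies below a
   join of translates of any s = n - 1 - k prescribed other elements
   p_0, ..., p_(s-1), using 1 + k + ... + k^t translates of p_t; the translates
   to be removed number at most 1 + k + ... + k^(n-k) <= phi(n+1).  At stage
   n - 1 every i lies below the empty join, so 1 = 0. *)
Require Import Defs.
From mathcomp Require Import zify ring lra.

Set Implicit Arguments. Unset Strict Implicit. Unset Printing Implicit Defensive.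
Import Order.TTheory GRing.Theory Num.Theory.

(** Since [0 ^ 0 = 1], the value at [k = 0] is 1, the weight needed at stage 0. *)
Definition geometric_sum (k t : nat) : nat := (\sum_(j < t.+1) k ^ j)%N.

Lemma geometric_sumS k t : geometric_sum k t.+1 = (k * geometric_sum k t).+1.
Proof.
rewrite /geometric_sum big_ord_recl expn0 add1n big_distrr /=.
by congr _.+1; apply: eq_bigr => j _; rewrite expnS.
Qed.

Lemma leq_geometric_sum k k' t : (k <= k')%N ->
  (geometric_sum k t <= geometric_sum k' t)%N.
Proof.
by move=> kk'; apply: leq_sum => -[[|j] jt] _ //=; rewrite leq_exp2r.
Qed.

(** * Covers by translates and their rewriting *)

Section Rewriting.
Variables (G : groupType) (d : Order.disp_t) (X : tbLatticeType d).
Variable act : G -> X -> X.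
Hypothesis X0distr : zero_distributive X.
Hypothesis GX : lattice_action act.
Local Open Scope order_scope.

Lemma act1 x : act 1%g x = x. Proof. by case: GX. Qed.
Lemma actM g h x : act (g * h)%g x = act g (act h x). Proof. by case: GX. Qed.
Lemma actU g x y : act g (x `|` y) = act g x `|` act g y.
Proof. by case: GX => _ _ /(_ g) []. Qed.
Lemma actI g x y : act g (x `&` y) = act g x `&` act g y.
Proof. by case: GX => _ _ /(_ g) []. Qed.
Lemma actK g : cancel (act g) (act g^-1%g).
Proof. by move=> x; rewrite -actM mulVg act1. Qed.
Lemma act_le g x y : x <= y -> act g x <= act g y.
Proof. by move/meet_idPl => <-; rewrite actI leIr. Qed.
Lemma act0 g : act g \bot = \bot.
Proof.
apply: le_anti; rewrite le0x andbT -[leRHS](actK g^-1%g) invgK.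
exact/act_le/le0x.
Qed.

Definition join_translates (L : seq (G * X)) : X := \join_(q <- L) act q.1 q.2.

Lemma join_translates_cat L1 L2 :
  join_translates (L1 ++ L2) = join_translates L1 `|` join_translates L2.
Proof. by rewrite /join_translates big_cat. Qed.

Lemma act_join_translates g L :
  act g (join_translates L) = join_translates [seq ((g * q.1)%g, q.2) | q <- L].
Proof.
rewrite /join_translates; elim: L => [|q L IH] /=; rewrite ?big_nil ?act0 //.
by rewrite !big_cons actU IH actM.
Qed.

Lemma meet_join_eq0 x L :
    {in L, forall q, x `&` act q.1 q.2 = \bot} ->
  x `&` join_translates L = \bot.
Proof.
rewrite /join_translates; elim: L => [|q L IH] H; first by rewrite big_nil meetx0.
rewrite big_cons X0distr H ?mem_head // join0x; apply: IH => r rL.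
by apply: H; rewrite in_cons rL orbT.
Qed.

(** [L] may repeat pairs, so the counts simply add when lists are concatenated. *)
Definition dominated (u : X -> nat) (i : X) : Prop :=
  exists2 L : seq (G * X),
    (forall x, (count (fun q => q.2 == x) L <= u x)%N) & i <= join_translates L.

Lemma dominatedW u v i :
  (forall x, (u x <= v x)%N) -> dominated u i -> dominated v i.
Proof. by move=> uv [L Lu iL]; exists L => // x; apply: leq_trans (uv x). Qed.

Lemma dominated_all (J : seq X) u :
    {in J, forall j, dominated u j} ->
  exists2 L : seq (G * X),
    (forall x, (count (fun q => q.2 == x) L <= size J * u x)%N) &
    {in J, forall j, j <= join_translates L}.
Proof.
elim: J => [|j J IH] H; first by exists [::].
have [|L Lu LJ] := IH; first by move=> k kJ; apply: H; rewrite in_cons kJ orbT.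
have [L' Lu' L'j] := H j (mem_head _ _).
exists (L' ++ L) => [x|k]; first by rewrite count_cat mulSn leq_add.
rewrite join_translates_cat in_cons => /predU1P[->|kJ].
  exact: le_trans L'j (leUl _ _).
exact: le_trans (LJ k kJ) (leUr _ _).
Qed.

Variables (A : {fset X}) (M : nat).
Hypothesis X01 : \bot <> \top :> X.
Hypothesis joinA : \join_(a <- A) a = \top.
Hypothesis sparse : forall (a : X) (F : seq G), a \in A -> (size F <= M)%N ->
  exists g, {in F, forall f, act g a `&` act f a = \bot}.

(** The elements of [i :: p] and the bounds on the elements of [J] together cover [\top]. A
    translate of [i] disjoint from all translates of [i] in this cover lies below the remaining
    ones. *)
Lemma dominated_step (p : seq X) (i : X) (u : X -> nat)
    (J := [seq x <- A | x \notin i :: p]) :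
    i \in A -> i \notin p ->
    (forall x, x \notin i :: p -> u x = 0) ->
    {in J, forall j, dominated u j} ->
    ((size J * u i).+1 <= M)%N ->
  dominated (fun x => if x \in p then (size J * u x).+1 else 0) i.
Proof.
move=> iA ip u0 HJ degi.
have [L Lu LJ] := dominated_all HJ.
(* The identity translates of [i :: p] account for the successor in [(size J * u x).+1]. *)
pose E := [seq (1%g : G, x) | x <- A & x \in i :: p] ++ L.
have Etop : \top <= join_translates E.
  rewrite -joinA; apply/joinsP_seq => x xA _; rewrite join_translates_cat.
  have [xp|xp] := boolP (x \in i :: p).
    apply: le_trans (leUl _ _); rewrite /join_translates big_map.
    rewrite (big_rem x) /= ?mem_filter ?xp //.
    by rewrite act1 leUl.
  by apply: le_trans (LJ x _) (leUr _ _); rewrite mem_filter xp.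
have Ecount x : (count (fun q => q.2 == x) E <=
    if x \in i :: p then (size J * u x).+1 else 0)%N.
  rewrite count_cat count_map /=.
  have -> : count (preim (fun y : X => (1%g : G, y)) (fun q => q.2 == x))
      [seq y <- A | y \in i :: p] = (x \in A) && (x \in i :: p) :> nat.
    rewrite (eq_count (a2 := pred1 x)) //.
    by rewrite count_uniq_mem ?filter_uniq ?fset_uniq // mem_filter andbC.
  have := Lu x; case: ifP => [_|/negbT xp]; last by rewrite u0 // muln0 andbF.
  by rewrite andbT; case: (x \in A) => /=; lia.
have [|g gE] := @sparse i [seq q.1 | q <- E & q.2 == i] iA.
  by rewrite size_map size_filter (leq_trans (Ecount i)) // mem_head.
exists [seq ((g^-1 * q.1)%g, q.2) | q <- E & q.2 != i].
  move=> x; rewrite count_map count_filter.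
  have [->|xi] := eqVneq x i.
    rewrite (eq_count (a2 := pred0)) ?count_pred0 // => q /=.
    by case: eqP.
  have := Ecount x; rewrite in_cons (negPf xi) /=; apply: leq_trans.
  by apply: sub_count => q /= /andP[].
rewrite -act_join_translates -[leLHS](actK g); apply: act_le.
have <- : act g i `&` join_translates E = act g i.
  by apply/meet_idPl; apply: le_trans Etop; exact: lex1.
have -> : join_translates E = join_translates [seq q <- E | q.2 == i] `|`
    join_translates [seq q <- E | q.2 != i].
  by rewrite /join_translates !big_filter (bigID (fun q => q.2 == i)).
have gi : act g i `&` join_translates [seq q <- E | q.2 == i] = \bot.
  apply: meet_join_eq0 => q qE.
  move: (qE); rewrite mem_filter => /andP[/eqP -> _].
  by apply: gE; apply: map_f.
by rewrite X0distr // gi join0x leIr.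
Qed.

(** * Bounds along chains of prescribed elements *)

(** Weights depend only on the position in [p], so one bound serves all elements and all orderings
    of a chain. *)
Definition dominated_by_chains (s : nat) (W : nat -> nat) : Prop :=
  forall (p : seq X) (i : X), uniq (i :: p) -> {subset i :: p <= A} ->
    size p = s -> dominated (fun x => if x \in p then W (index x p) else 0%N) i.

Lemma dominated_by_chainsW s W W' : (forall t, (t < s)%N -> (W t <= W' t)%N) ->
  dominated_by_chains s W -> dominated_by_chains s W'.
Proof.
move=> WW' H p i ip ipA sp; apply: dominatedW (H p i ip ipA sp) => x.
by case: ifP => // xp; apply: WW'; rewrite -sp index_mem.
Qed.

Lemma size_complement (p : seq X) : uniq p -> {subset p <= A} ->
  size [seq x <- A | x \notin p] = (#|` A| - size p)%N.
Proof.
move=> up pA; rewrite size_filter -(count_predC (mem p) A) /=.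
rewrite -[X in (X + _ - _)%N]size_filter.
have /perm_size -> : perm_eq [seq x <- A | mem p x] p.
  apply: uniq_perm => //; first by rewrite filter_uniq ?fset_uniq.
  by move=> x; rewrite mem_filter /=; apply/andb_idr/pA.
by rewrite addKn; apply: eq_count.
Qed.

Lemma uniq_complement_cons (p q : seq X) j :
    uniq q -> {subset q <= p} -> {subset p <= A} ->
    j \in [seq x <- A | x \notin p] ->
  uniq (j :: q) /\ {subset j :: q <= A}.
Proof.
rewrite mem_filter => uq qp pA /andP[jp jA]; split.
  by rewrite /= uq andbT; apply: contra jp => /qp.
by move=> x; rewrite in_cons => /predU1P[-> //|/qp/pA].
Qed.

(** Here [i :: p] exhausts [A], so the cover is [A] itself and only [i] has to be removed. *)
Lemma dominated_by_chains0 : (0 < M)%N ->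
  dominated_by_chains #|` A|.-1 (fun=> 1%N).
Proof.
move=> M0 p i ip ipA sp.
have iA : i \in A by apply/ipA/mem_head.
have J0 : [seq x <- A | x \notin i :: p] = [::].
  have A0 : (0 < #|` A|)%N by rewrite cardfs_gt0; apply/fset0Pn; exists i.
  by apply/size0nil; rewrite size_complement //= sp prednK // subnn.
have := @dominated_step p i (fun=> 0%N) iA.
rewrite J0 /=; apply => //; by case/andP: ip.
Qed.

(** Each of the [k] elements outside [i :: p] is bounded along [rcons p i]; the last weight [W s]
    counts the translates of [i] to be removed. *)
Lemma chains_shorten s W (k := (#|` A| - s.+1)%N) : ((k * W s).+1 <= M)%N ->
  dominated_by_chains s.+1 W ->
  dominated_by_chains s (fun t => (k * W t).+1).
Proof.
move=> degM H p i ip ipA sp.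
have iA : i \in A by apply/ipA/mem_head.
have /andP[iNp up] := ip.
pose u x := if x \in rcons p i then W (index x (rcons p i)) else 0%N.
have sJ : size [seq x <- A | x \notin i :: p] = k.
  by rewrite size_complement //= sp.
have idx_i : index i (rcons p i) = s.
  by rewrite -cats1 index_cat (negPf iNp) /= eqxx addn0.
have := @dominated_step p i u iA iNp.
rewrite sJ; case => [x|j jJ||L Lu iL].
- by rewrite /u mem_rcons => /negPf ->.
- have [||uj jA] := @uniq_complement_cons _ (rcons p i) _ _ _ ipA jJ.
  + by rewrite rcons_uniq iNp.
  + by move=> x; rewrite mem_rcons.
  by apply: H => //; rewrite size_rcons sp.
- by rewrite /u mem_rcons mem_head idx_i.
exists L => // x; apply: leq_trans (Lu x) _; case: ifP => // xp.
by rewrite /u mem_rcons in_cons xp orbT -cats1 index_cat xp.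
Qed.

(** Elements outside [i :: q :: r] are bounded along [rcons r i], which omits [q]. So [q] occurs
    only as its own identity translate, and elements of [r] take their weights from one position
    earlier. *)
Lemma chains_shift s W (k := (#|` A| - s.+2)%N) : ((k * W s).+1 <= M)%N ->
  dominated_by_chains s.+1 W ->
  dominated_by_chains s.+1 (fun t => if t is t'.+1 then (k * W t').+1 else 1%N).
Proof.
move=> degM H [//|q r] i ip ipA [sr].
have iA : i \in A by apply/ipA/mem_head.
have /andP[iNp up] := ip; have /andP[qr ur] := up.
have /norP[iq ir] : ~~ ((i == q) || (i \in r)) by rewrite -in_cons.
pose u x := if x \in rcons r i then W (index x (rcons r i)) else 0%N.
have sJ : size [seq x <- A | x \notin i :: q :: r] = k.
  by rewrite size_complement //= sr.
have idx_i : index i (rcons r i) = s.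
  by rewrite -cats1 index_cat (negPf ir) /= eqxx addn0.
have := @dominated_step (q :: r) i u iA iNp.
rewrite sJ; case => [x|j jJ||L Lu iL].
- by rewrite /u mem_rcons !in_cons => /norP[/negPf-> /norP[_ /negPf->]].
- have [||uj jA] := @uniq_complement_cons _ (rcons r i) _ _ _ ipA jJ.
  + by rewrite rcons_uniq ir.
  + by move=> x; rewrite mem_rcons !in_cons => /orP[->|->]; rewrite ?orbT.
  by apply: H => //; rewrite size_rcons sr.
- by rewrite /u mem_rcons mem_head idx_i.
exists L => // x; apply: leq_trans (Lu x) _; case: ifP => //.
rewrite in_cons /u mem_rcons in_cons => /predU1P[->|xr].
  by rewrite eq_sym (negPf iq) (negPf qr) /= eqxx muln0.
have -> : index x (q :: r) = (index x r).+1.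
  by rewrite /=; case: eqP => // qx; rewrite qx xr in qr.
by rewrite xr orbT -cats1 index_cat xr.
Qed.

(** Shortening the chains of stage [k] yields weights whose exponents are one too large; [s] shifts
    then correct them one position at a time from the front. *)
Lemma dominated_by_geometric_chains k : (0 < M)%N ->
    (forall k', (0 < k' < #|` A|)%N ->
      (geometric_sum k' (#|` A| - k') <= M)%N) ->
    (k < #|` A|)%N ->
  dominated_by_chains (#|` A|.-1 - k) (geometric_sum k).
Proof.
move=> M0 HM; elim: k => [_|k IH kA].
  rewrite subn0; apply: dominated_by_chainsW (dominated_by_chains0 M0) => t _.
  by rewrite /geometric_sum big_ord_recl expn0 leq_addr.
set s := (#|` A|.-1 - k.+1)%N; set N := #|` A| in kA IH HM s *.
have sk : (N - s.+1)%N = k.+1 by rewrite /s; lia.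
(* The largest removal count in this stage: the last weight before correction is
   [geometric_sum k.+1 s]. *)
have degM : ((k.+1 * geometric_sum k.+1 s).+1 <= M)%N.
  by rewrite -geometric_sumS (_ : s.+1 = N - k.+1)%N ?HM //; rewrite /s; lia.
have S0 : dominated_by_chains s (fun t => geometric_sum k.+1 t.+1).
  have E : (N.-1 - k)%N = s.+1 by rewrite /s; lia.
  have {IH} := IH (ltnW kA); rewrite E => /chains_shorten; rewrite -/N sk => H.
  apply: dominated_by_chainsW (H _) => [t _|].
    by rewrite geometric_sumS ltnS leq_mul2l leq_geometric_sum ?orbT.
  apply: leq_trans degM; rewrite ltnS leq_mul2l leq_geometric_sum ?orbT //.
(* The first [l] weights have reached their final values. *)
have Sl l : (l <= s)%N -> dominated_by_chains s
    (fun t => geometric_sum k.+1 (if (t < l)%N then t else t.+1)).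
  elim: l => [_|l IHl ls]; first exact: S0.
  have {IHl} := IHl (ltnW ls).
  have [s' Es] : exists s', s = s'.+1 by exists s.-1; rewrite prednK // (leq_ltn_trans _ ls).
  move: ls sk degM; rewrite Es => ls sk degM /chains_shift.
  (* The last position [s'] is not yet corrected, so the removal count is the one bounded by
     [degM]. *)
  rewrite -/N sk (_ : (s' < l)%N = false) => [H|]; last by rewrite ltnNge (_ : (l <= s')%N).
  apply: dominated_by_chainsW (H _) => [t _|]; last first.
    exact: degM.
  case: t => [|t].
    by rewrite /geometric_sum /= big_ord_recl expn0 leq_addr.
  by rewrite ltnS -geometric_sumS; case: ifP.
apply: dominated_by_chainsW (Sl s (leqnn s)) => t ts.
by rewrite ts.
Qed.

Lemma no_sparse_cover : (0 < M)%N ->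
    (forall k, (0 < k < #|` A|)%N -> (geometric_sum k (#|` A| - k) <= M)%N) ->
  False.
Proof.
move=> M0 HM; apply: X01; apply: le_anti; rewrite le0x -joinA /=.
apply/joinsP_seq => a aA _.
have A0 : (0 < #|` A|)%N by rewrite cardfs_gt0; apply/fset0Pn; exists a.
have := @dominated_by_geometric_chains #|` A|.-1 M0 HM.
rewrite prednK // subnn => /(_ (leqnn _) [::] a) [//||//|L L0 aL].
  by move=> x; rewrite inE => /eqP->.
(* The chain is empty, so all multiplicities vanish and [L] is empty. *)
have -> : \bot = join_translates L; last exact: aL.
case: L L0 {aL} => [|q L] L0; first by rewrite /join_translates big_nil.
by have := L0 q.2; rewrite /= eqxx.
Qed.

End Rewriting.

(** * Lower bounds for [phi] *)

Section Phi.
Variable R : realType.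
Local Open Scope ring_scope.

Lemma phi_ge_quotient m (x : R) : 1 < x < m%:R ->
  (x `^ (m%:R - x) - 1) / (x - 1) <= phi R m.
Proof.
move=> xm; apply: ub_le_sup; last by exists x.
(* An upper bound, from [y^(m-y) <= y^m] and the factorization of [y^m - 1]. *)
exists (\sum_(i < m) m%:R ^+ i) => _ [y /andP[y1 ym] <-].
have y0 : 0 < y - 1 by rewrite subr_gt0.
have yge0 : 0 <= y by rewrite ltW // (lt_trans ltr01).
rewrite ler_pdivrMr // mulrC.
apply: (@le_trans _ _ (y ^+ m - 1)).
  rewrite lerD2r -powR_mulrn //; apply: ler_powR; first exact: ltW.
  by rewrite lerBlDr lerDl.
rewrite subrX1; apply: ler_wpM2l; first exact: ltW.
by apply: ler_sum => i _; apply: lerXn2r; rewrite ?nnegrE ?ler0n // ltW.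
Qed.

(* The quotient tends to [n] as [x] decreases to 1. *)
Lemma phi_ge_nat n : (0 < n)%N -> n%:R <= phi R n.+1.
Proof.
move=> n0; apply/ler_addgt0Pr => e e0.
have n1 : 1 <= n%:R :> R by rewrite ler1n.
(* The first bound keeps [1 + t] below [n + 1]; the second gives [(n - t) / (1 + t) >= n - e]. *)
pose t := Num.min (2^-1) (e / n.+1%:R).
have t0 : 0 < t by rewrite lt_min divr_gt0 ?invr_gt0 ?ltr0n.
have t2 : t <= 2^-1 by rewrite ge_min lexx.
have te : t * n.+1%:R <= e.
  by rewrite -ler_pdivlMr ?ltr0n // ge_min lexx orbT.
rewrite -natr1 in te.
have tn : (1 : R) < 1 + t < n.+1%:R by rewrite -natr1; apply/andP; split; lra.
rewrite -lerBlDr; apply: le_trans (phi_ge_quotient tn).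
rewrite [X in _ / X](_ : _ = t); last by ring.
have t1 : 0 < 1 + t by lra.
have ln_lb : t / (1 + t) <= ln (1 + t).
  have -> : ln (1 + t) = - ln (1 + - (t / (1 + t))).
    rewrite (_ : 1 + - _ = (1 + t)^-1) ?lnV ?posrE ?opprK //.
    by field; rewrite gt_eqF.
  rewrite lerNr; apply: le_ln1Dx.
  by rewrite ltrN2 ltr_pdivrMr //; lra.
rewrite /powR gt_eqF //.
have nt : 0 <= n%:R - t by lra.
rewrite [n.+1%:R - _](_ : _ = n%:R - t); last by rewrite -natr1; ring.
apply: (@le_trans _ _ (((n%:R - t) * (t / (1 + t))) / t)); last first.
  rewrite ler_pM2r ?invr_gt0 // lerBrDl.
  apply: le_trans (expR_ge1Dx _); rewrite lerD2l.
  exact: ler_wpM2l.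
have -> : (n%:R - t) * (t / (1 + t)) / t = (n%:R - t) / (1 + t).
  by field; rewrite !gt_eqF.
rewrite ler_pdivlMr //.
have et : 0 <= e * t by rewrite mulr_ge0 ?ltW.
lra.
Qed.

(** For [k >= 2] the sum is the quotient at [x = k]. The excluded point [x = 1] is handled by the
    limit value [n]. *)
Lemma phi_ge_geometric_sum n k : (0 < k < n)%N ->
  (geometric_sum k (n - k))%:R <= phi R n.+1.
Proof.
case: k => [//|[|k]] /= kn.
  rewrite (_ : geometric_sum _ _ = n) ?phi_ge_nat //; first by lia.
  rewrite /geometric_sum (eq_bigr (fun=> 1%N)) => [|j _]; last by rewrite exp1n.
  by rewrite sum1_card card_ord subn1 prednK // ltnW.
have kn' : 1 < (k.+2%:R : R) < n.+1%:R.
  by apply/andP; split; rewrite ?ltr1n // ltr_nat ltnS ltnW.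
apply: le_trans (phi_ge_quotient kn').
rewrite -natrB; last by lia.
rewrite powR_mulrn ?ler0n // subrX1 mulrC mulKf; last first.
  by rewrite subr_eq0 pnatr_eq1.
rewrite /geometric_sum natr_sum subSn; last exact: ltnW.
by under eq_bigr do rewrite natrX.
Qed.

End Phi.

(** * Finite values of lar *)

Section Lar.
Variables (R : realType) (G : groupType).
Local Open Scope classical_set_scope.
Local Open Scope card_scope.

Lemma is_lar_of_cover (D : set G) (F : seq G) :
    (forall g, exists2 f, f \in F & D (f^-1 * g)%g) ->
  exists k, [/\ (0 < k)%N, (k <= size F)%N & is_lar D `I_k].
Proof.
move=> FD.
have D0 : D !=set0 by have [f _ Df] := FD 1%g; exists (f^-1 * 1)%g.
have cF : `[< exists2 E : set G, covers E D & E #= `I_#|` [fset f in F]%fset| >].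
  apply/asboolP; exists [set` [fset f in F]%fset]; last exact/card_eq_fsetP.
  apply/seteqP; split => // g _; have [f fF Df] := FD g.
  exists f; first by rewrite /= !inE.
  by exists (f^-1 * g)%g; rewrite // mulVKg.
case: (ex_minnP (ex_intro (fun k => `[< exists2 E : set G, covers E D & E #= `I_k >]) _ cF)).
move=> k /asboolP[E cE Ek] kmin; exists k; split.
- rewrite lt0n; apply/eqP => k0; move: Ek; rewrite k0 II0 card_eq0 => /eqP E0.
  have : [set: G] 1%g by [].
  by rewrite -cE E0 => -[].
- by rewrite (leq_trans (kmin _ cF)) // card_fseq size_undup.
split=> [_|De]; last by move: D0; rewrite De => -[].
split; first by exists E => //; rewrite card_eq_sym.
move=> E' cE'; have [[l E'l]|] := pselect (exists l, E' #= `I_l).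
  have kl : (k <= l)%N by apply: kmin; apply/asboolP; exists E'.
  apply: (@card_le_trans _ _ _ `I_l); first by rewrite card_le_II.
  by move: E'l; rewrite card_eq_le => /andP[].
(* An infinite cover contains a copy of the naturals, hence of [I_k]. *)
move=> /finite_setP/infiniteP; apply: card_le_trans.
exact: subset_card_le.
Qed.

Lemma is_lar_unique (D : set G) k l : D !=set0 ->
  is_lar D `I_k -> is_lar D `I_l -> k = l.
Proof.
have le_lar k' l' : D !=set0 -> is_lar D `I_k' -> is_lar D `I_l' -> (k' <= l')%N.
  move=> D0 [/(_ D0)[_ Hk] _] [/(_ D0)[[F cF lF] _] _].
  rewrite -card_le_II; apply: card_le_trans (Hk F cF) _.
  by move: lF; rewrite card_eq_le => /andP[].
by move=> D0 Hk Hl; apply/eqP; rewrite eqn_leq !le_lar.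
Qed.

End Lar.

(* \join over A is \bot for A = fset0, so the case n = 0 is vacuous *)
Theorem theorem1p10 (R : realType) (G : groupType) (d : Order.disp_t)
    (X : tbLatticeType d) (act : G -> X -> X) (A : {fset X}) (n : nat)
    (X01 : \bot%O <> \top%O :> X)
    (X0distr : zero_distributive X)
    (GX : lattice_action act)
    (cardA : #|` A| = n)
    (joinA : (\join_(a <- A) a)%O = \top%O) :
  exists2 a : X, a \in A &
    lar_le (Delta act a) (phi R n.+1) /\
    (protasov_density R act a >= 1 / phi R n.+1)%R.
Proof.
have n0 : (0 < n)%N.
  rewrite -cardA cardfs_gt0; apply/eqP => A0.
  by apply: X01; rewrite -joinA A0 big_seq_fset0.
have phi_n : (n%:R <= phi R n.+1)%R := phi_ge_nat R n0.
have phi0 : (0 < phi R n.+1)%R by apply: lt_le_trans phi_n; rewrite ltr0n.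
(* Cover sizes are natural numbers, so [phi] may be replaced by its integer part. *)
pose M := Num.truncn (phi R n.+1).
have leM k : (k <= M)%N = (k%:R <= phi R n.+1)%R by apply/truncn_ge_nat/ltW.
have [a aA [F FM FD]] : exists2 a, a \in A & exists2 F : seq G, (size F <= M)%N &
    forall g, exists2 f, f \in F & Delta act a (f^-1 * g)%g.
  apply: contrapT => noF; apply: (@no_sparse_cover _ _ _ act X0distr GX A M) => //.
  - move=> a F aA FM; apply: contrapT => /forallNP Fa; apply: noF.
    exists a => //; exists F => // g.
    (* If [g] is outside the product of [F] and [Delta act a], then [f^-1 g a] is disjoint from [a];
       apply [f]. *)
    apply: contrapT => /forall2NP FD; apply: (Fa g) => f fF.
    have [//|/contrapT fga] := FD f.
    have := congr1 (act f) fga.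
    by rewrite (actI GX) -(actM GX) mulVKg (act0 GX).
  - by rewrite leM (le_trans _ phi_n) // ler1n.
  - by move=> k; rewrite cardA leM => /phi_ge_geometric_sum; apply.
have D0 : (Delta act a !=set0)%classic.
  by have [f _ Df] := FD 1%g; exists (f^-1 * 1)%g.
have [k [k0 kF lar_k]] := is_lar_of_cover FD.
have k_phi : (k%:R <= phi R n.+1)%R by rewrite -leM (leq_trans kF).
exists a => //; split; first by exists k.
(* Uniqueness of lar forces the value [1 / k], and the default 0 is excluded because [1 / k] is in
   the set. *)
rewrite /protasov_density; case: xgetP => [r _ [l [l0 lar_l ->]]|/(_ (1 / k%:R)%R)].
  rewrite -(is_lar_unique D0 lar_k lar_l).
  by rewrite !div1r lef_pV2 // posrE ltr0n.
by case; exists k.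
Qed.
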